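(* Let $\lambda>1$, $\theta>0$, $\lambda_j=\lambda^j$, $f_0\ge0$ and $f_j=0$ for all $j\ge1$. Let $(a(t),b(t))$ be a weak solution on $[0,\infty)$ of the system $$\frac{d}{dt}a_j=-\left(\lambda_j^{\theta}a_ja_{j+1}-\lambda_{j-1}^{\theta}a_{j-1}^2\right)-\left(\lambda_j^{\theta}b_jb_{j+1}-\lambda_{j-1}^{\theta}b_{j-1}^2\right)+f_j,\qquad \frac{d}{dt}b_j=\lambda_j^{\theta}a_jb_{j+1}-\lambda_j^{\theta}b_ja_{j+1},$$ for $j\ge0$ with $a_{-1}=b_{-1}=0$, with positive initial data, i.e. $a_j(0)>0$ and $b_j(0)>0$ for all $j\ge0$. Then for every $s>\frac13\theta$ the solution blows up at a finite time in the $H^s$ norm: there exists a finite $T>0$ such that $$\sup_{t\in[0,T]}\left(\|a(t)\|_{H^s}^2+\|b(t)\|_{H^s}^2\right)=\infty .$$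
   Context: $l^2$ is the space of real sequences $u=(u_0,u_1,\dots)$ with $\sum_{j\ge0}u_j^2<\infty$. For a real sequence $u$, $\|u\|_{H^s}^2=\sum_{j\ge0}\lambda_j^{2s}u_j^2\in[0,\infty]$. A weak solution on $[0,\infty)$ is a pair of $l^2$-valued functions $(a(t),b(t))$ on $[0,\infty)$ such that $a_j,b_j\in C^1([0,\infty))$ for all $j\ge0$ and the equations of the system hold for all $j\ge0$. *)

(* Defs.v *)
From Stdlib Require Import Reals.
From Coquelicot Require Import Coquelicot.
Open Scope R_scope.

Definition in_l2 (u : nat -> R) : Prop := ex_series (fun j => (u j) ^ 2).

(* The value is p_infty exactly when the series diverges: the terms are
   nonnegative, so the partial sums are nondecreasing and Lim_seq is their
   limit in [0, +oo]. *)
Definition Hs_norm_sq (lam s : R) (u : nat -> R) : Rbar :=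
  Lim_seq (sum_n (fun j => Rpower (lam ^ j) (2 * s) * (u j) ^ 2)).

Definition half_line (t : R) : Prop := 0 <= t.

(* D_in and continue_in are relative to the domain D, so the derivative at an
   endpoint of D is one-sided and values of g outside D are irrelevant. *)
Definition C1_on (D : R -> Prop) (g : R -> R) : Prop :=
  exists d : R -> R, forall t, D t -> D_in g d D t /\ continue_in d D t.

(* lam_(j-1)^theta u_(j-1)^2, which is 0 for j = 0 since u_(-1) = 0. *)
Definition inflow (lam theta : R) (u : nat -> R) (j : nat) : R :=
  match j with
  | O => 0
  | S k => Rpower (lam ^ k) theta * (u k) ^ 2
  end.

Definition rhs_a (lam theta : R) (f a b : nat -> R) (j : nat) : R :=
  - (Rpower (lam ^ j) theta * a j * a (S j) - inflow lam theta a j)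
  - (Rpower (lam ^ j) theta * b j * b (S j) - inflow lam theta b j)
  + f j.

Definition rhs_b (lam theta : R) (a b : nat -> R) (j : nat) : R :=
  Rpower (lam ^ j) theta * a j * b (S j)
  - Rpower (lam ^ j) theta * b j * a (S j).

Definition weak_solution (lam theta : R) (f : nat -> R)
    (a b : R -> nat -> R) : Prop :=
  (forall t, 0 <= t -> in_l2 (a t) /\ in_l2 (b t)) /\
  (forall j, C1_on half_line (fun t => a t j) /\
             C1_on half_line (fun t => b t j)) /\
  (forall j t, 0 <= t ->
     D_in (fun r => a r j) (fun r => rhs_a lam theta f (a r) (b r) j)
       half_line t /\
     D_in (fun r => b r j) (fun r => rhs_b lam theta (a r) (b r) j)
       half_line t).

(* Main.v *)
(** With [z_j = a_j + i b_j] the equation for [a_j] reads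
    [a_j' = - mu^j Re (z_j conj z_(j+1)) + mu^(j-1) |z_(j-1)|^2 + f_j], where
    [mu = lam^theta].  For [mu^(-1/3) < r <= 1] the functional
    [Phi = sum_j r^j a_j] therefore satisfies
    [Phi' >= c sum_j (mu r)^j |z_j|^2 >= c' Phi^2] by the AM-GM and
    Cauchy-Schwarz inequalities, whatever the signs of [a_j] and [b_j] at
    positive times, and [Phi 0 > 0]; so [Phi] would blow up at an explicit time.
    If [mu r < lam^(2s)] and the [H^s] norm is bounded by [M], truncating [Phi]
    at [N] costs an error [O (M q^N)] with [q < 1], uniformly in time, so that
    one large [N] suffices for the contradiction. *)

Require Import Defs.
From Stdlib Require Import Reals Lra Lia.
From Coquelicot Require Import Coquelicot.
Open Scope R_scope.

(** * Elementary identities and inequalities for finite sums *)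

Lemma Rpower_pow_base (x y : R) (j : nat) :
  0 < x -> Rpower (x ^ j) y = Rpower x y ^ j.
Proof.
intros hx. rewrite <- !Rpower_pow, !Rpower_mult; [f_equal; ring | | exact hx].
apply exp_pos.
Qed.

Lemma Cauchy_Schwarz_sum (x y : nat -> R) (n : nat) :
  (sum_f_R0 (fun j => x j * y j) n) ^ 2 <=
  sum_f_R0 (fun j => x j ^ 2) n * sum_f_R0 (fun j => y j ^ 2) n.
Proof.
induction n as [|n IH]; [simpl; nra | rewrite !tech5].
assert (hX := cond_pos_sum (fun j => x j ^ 2) n (fun j => pow2_ge_0 _)).
assert (hY := cond_pos_sum (fun j => y j ^ 2) n (fun j => pow2_ge_0 _)).
revert IH hX hY.
generalize (sum_f_R0 (fun j => x j * y j) n) (sum_f_R0 (fun j => x j ^ 2) n)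
  (sum_f_R0 (fun j => y j ^ 2) n) (x (S n)) (y (S n)).
intros s X Y p q IH hX hY.
(* The cross term of the inductive step, obtained by comparing squares: [4 s^2 p^2 q^2 <= 4 X Y p^2
   q^2 <= (X q^2 + Y p^2)^2]. *)
assert (h : 2 * s * (p * q) <= X * q ^ 2 + Y * p ^ 2).
{ assert (h0 : 0 <= X * q ^ 2 + Y * p ^ 2)
    by (apply Rplus_le_le_0_compat; apply Rmult_le_pos; auto using pow2_ge_0).
  apply Rsqr_incr_0_var; [|exact h0].
  assert (h1 : s ^ 2 * (p * q) ^ 2 <= X * Y * (p * q) ^ 2)
    by (apply Rmult_le_compat_r; [apply pow2_ge_0 | exact IH]).
  assert (h2 := pow2_ge_0 (X * q ^ 2 - Y * p ^ 2)).
  unfold Rsqr; nra. }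
nra.
Qed.

Lemma geometric_sum_le (w : R) (n : nat) :
  0 <= w < 1 -> sum_f_R0 (fun j => w ^ j) n <= / (1 - w).
Proof.
intros hw. rewrite tech3 by lra.
assert (h := pow_le w (S n) (proj1 hw)).
unfold Rdiv. rewrite <- (Rmult_1_l (/ (1 - w))) at 2.
apply Rmult_le_compat_r; [|lra].
left; apply Rinv_0_lt_compat; lra.
Qed.

(** * Calculus on the half-line and the Riccati inequality *)

(** Precomposing with [Rmax 0] extends [g] by the constant [g 0] to negative times, which turns
    one-sided continuity at 0 into the two-sided notion used by the mean value theorem. *)
Lemma continuity_of_D_in_half_line (g d : R -> R) :
  (forall t, 0 <= t -> D_in g d half_line t) ->
  forall t, continuity_pt (fun r => g (Rmax 0 r)) t.
Proof.
intros hg t eps heps.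
destruct (cont_deriv _ _ _ _ (hg (Rmax 0 t) (Rmax_l _ _)) eps heps)
  as [del [hdel h]].
exists del; split; [exact hdel|].
intros x [_ hx]. simpl in *. unfold R_dist in *.
(* The limit in [continue_in] excludes the base point, and [Rmax 0] can identify distinct points. *)
destruct (Req_dec (Rmax 0 t) (Rmax 0 x)) as [e|ne].
- rewrite <- e, Rminus_diag, Rabs_R0. exact heps.
- apply h. split.
  + split; [apply Rmax_l | exact ne].
  + apply Rle_lt_trans with (2 := hx).
    unfold Rmax, Rabs; destruct (Rle_dec 0 x), (Rle_dec 0 t);
      repeat destruct Rcase_abs; lra.
Qed.

Lemma derive_of_D_in_half_line (g d : R -> R) (t : R) :
  0 < t -> D_in g d half_line t ->
  is_derive (fun r => g (Rmax 0 r)) t (d t).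
Proof.
intros ht hg. apply is_derive_Reals. intros eps heps.
destruct (hg eps heps) as [del [hdel h]].
(* Capping the radius at [t] keeps [t + x] positive, where [Rmax 0] is the identity. *)
assert (hm : 0 < Rmin del t) by (apply Rmin_glb_lt; lra).
exists (mkposreal _ hm); intros x hx0 hx; simpl in hx.
assert (hx1 := Rlt_le_trans _ _ _ hx (Rmin_l _ _)).
assert (hx2 := Rlt_le_trans _ _ _ hx (Rmin_r _ _)).
apply Rabs_def2 in hx2.
rewrite !Rmax_right by lra.
specialize (h (t + x)). simpl in h. unfold R_dist in h.
replace (t + x - t) with x in h by ring.
apply h. split; [split|exact hx1].
- unfold half_line; lra.
- lra.
Qed.

Lemma nondecreasing_of_derive (F dF : R -> R) (T : R) :
  0 <= T ->
  (forall t, 0 <= t <= T -> continuity_pt F t) ->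
  (forall t, 0 < t < T -> is_derive F t (dF t)) ->
  (forall t, 0 <= t <= T -> 0 <= dF t) ->
  F 0 <= F T.
Proof.
intros hT hc hd hp.
destruct (MVT_gen F 0 T dF) as [c [hc1 hc2]];
  rewrite ?Rmin_left, ?Rmax_right in * by lra; auto.
assert (h := hp c hc1). nra.
Qed.

(** Once [g >= A] is known to persist, the loss [c A^2 / 2] is at most half of [c g^2], so
    [g' >= c g^2 / 2] and [- 1/g] grows at rate at least [c / 2]. It starts at or above [- 1/A],
    hence would be nonnegative by time [2 / (c A)], although [g] is still positive. *)
Lemma Riccati_blowup (g dg : R -> R) (A c T : R) :
  0 < A -> 0 < c -> 2 / (c * A) <= T ->
  (forall t, continuity_pt g t) ->
  (forall t, 0 < t < T -> is_derive g t (dg t)) ->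
  (forall t, 0 <= t <= T -> c * g t ^ 2 - c * A ^ 2 / 2 <= dg t) ->
  A <= g 0 -> False.
Proof.
intros hA hc hT gc gd hg g0.
assert (hcA : 0 < c * A) by nra.
assert (hT0 : 0 < 2 / (c * A)) by (apply Rdiv_lt_0_compat; lra).
(* [c g^2 - c A^2 / 2 >= 2 c A (g - A)], so [g - A] dominates an exponential. *)
assert (low : forall t, 0 <= t <= T -> A <= g t).
{ intros t ht.
  assert (h : exp (- (2 * c * A) * 0) * (g 0 - A)
              <= exp (- (2 * c * A) * t) * (g t - A)).
  { apply (nondecreasing_of_derive
      (fun u => exp (- (2 * c * A) * u) * (g u - A))
      (fun u => exp (- (2 * c * A) * u) *
                (dg u - 2 * c * A * (g u - A)))); [lra| | |].
    - intros u hu. apply continuity_pt_mult.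
      + apply derivable_continuous_pt.
        exists (- (2 * c * A) * exp (- (2 * c * A) * u)).
        apply is_derive_Reals. auto_derive; [exact I | ring].
      + apply continuity_pt_minus; [apply gc|].
        apply continuity_pt_const. intros ? ?; reflexivity.
    - intros u hu.
      assert (hd : is_derive g u (dg u)) by (apply gd; lra).
      auto_derive; [exists (dg u); exact hd|].
      rewrite (is_derive_unique (fun v : R => g v) u _ hd). ring.
    - intros u hu. apply Rmult_le_pos; [left; apply exp_pos|].
      assert (h := hg u ltac:(lra)).
      assert (h2 := pow2_ge_0 (g u - A)). nra. }
  rewrite Rmult_0_r, exp_0 in h.
  assert (he := exp_pos (- (2 * c * A) * t)). nra. }
assert (h : - / g 0 - c / 2 * 0 <= - / g T - c / 2 * T).
{ apply (nondecreasing_of_derive (fun u => - / g u - c / 2 * u)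
    (fun u => dg u / g u ^ 2 - c / 2)); [lra| | |].
  - intros u hu. assert (hl := low u hu).
    apply continuity_pt_minus.
    + apply continuity_pt_opp, continuity_pt_inv; [apply gc | lra].
    + apply derivable_continuous_pt. exists (c / 2).
      apply is_derive_Reals. auto_derive; [exact I | ring].
  - intros u hu. assert (hl := low u ltac:(lra)).
    assert (hd := gd u hu).
    auto_derive; [split; [exists (dg u); exact hd | split; [lra | exact I]]|].
    rewrite (is_derive_unique (fun v : R => g v) u _ hd). field. lra.
  - intros u hu. assert (hl := low u hu). assert (h := hg u hu).
    assert (hd : c / 2 <= dg u / g u ^ 2); [|lra].
    apply (Rle_div_r (c / 2)); [apply pow_lt; lra|].
    assert (hA2 : A ^ 2 <= g u ^ 2) by (apply pow_incr; lra). nra. }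
assert (h0 : / g 0 <= / A) by (apply Rinv_le_contravar; lra).
assert (h1 : 0 < / g T).
{ apply Rinv_0_lt_compat. assert (hl := low T ltac:(lra)). lra. }
assert (h2 : c / 2 * (2 / (c * A)) <= c / 2 * T)
  by (apply Rmult_le_compat_l; lra).
replace (c / 2 * (2 / (c * A))) with (/ A) in h2 by (field; lra).
lra.
Qed.

(** * Differential inequality for the truncated functional *)

(** The two sides differ by [k / 2] times a sum of two squares. With [k = rho^(-1/2)], multiplying
    by [rho^j] gives the weighted energies of levels [j] and [j + 1] the same coefficient. *)
Lemma AM_GM_dot (k rho x y x' y' : R) :
  0 < k -> k ^ 2 * rho = 1 ->
  x * x' + y * y' <=
  k / 2 * ((x ^ 2 + y ^ 2) + rho * (x' ^ 2 + y' ^ 2)).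
Proof.
intros hk h.
assert (hr : rho = / k * / k).
{ apply (Rmult_eq_reg_l (k ^ 2)); [rewrite h; field; lra | nra]. }
subst rho.
replace (k / 2 * ((x ^ 2 + y ^ 2) + / k * / k * (x' ^ 2 + y' ^ 2))) with
  (x * x' + y * y' + k / 2 * ((x - x' / k) ^ 2 + (y - y' / k) ^ 2))
  by (field; lra).
assert (h1 := pow2_ge_0 (x - x' / k)). assert (h2 := pow2_ge_0 (y - y' / k)).
nra.
Qed.

(** Write [E_j = rho^j (x_j^2 + y_j^2)]. The inflow into level [j + 1] contributes [r E_j], while
    the outflow from level [j] costs at most [k / 2 (E_j + E_(j+1))]. After summation each [E_j]
    keeps [r - k], and the subtracted terms come from the cut: the inflow to level [N + 1] is
    missing, and the outflow from level [N] involves [E_(N+1)]. *)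
Lemma weighted_sum_rhs_a_ge (lam theta : R) (f x y : nat -> R)
    (r k rho : R) (N : nat) :
  0 < lam -> 0 < r -> 0 < k ->
  rho = r * Rpower lam theta -> k ^ 2 * rho = 1 ->
  0 <= f 0%nat -> (forall j : nat, (1 <= j)%nat -> f j = 0) ->
  (r - k) * sum_f_R0 (fun j => rho ^ j * (x j ^ 2 + y j ^ 2)) N
  - r * (rho ^ N * (x N ^ 2 + y N ^ 2))
  - k / 2 * (rho ^ S N * (x (S N) ^ 2 + y (S N) ^ 2))
  <= sum_f_R0 (fun j => r ^ j * rhs_a lam theta f x y j) N.
Proof.
intros hlam hr hk erho hkr hf0 hf.
assert (hmu : 0 < Rpower lam theta) by apply exp_pos.
assert (hrho : 0 < rho) by (rewrite erho; nra).
assert (flux : forall j,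
  rho ^ j * (x j * x (S j) + y j * y (S j)) <=
  k / 2 * (rho ^ j * (x j ^ 2 + y j ^ 2)
           + rho ^ S j * (x (S j) ^ 2 + y (S j) ^ 2))).
{ intros j.
  assert (h := AM_GM_dot k rho (x j) (y j) (x (S j)) (y (S j)) hk hkr).
  apply (Rmult_le_compat_l (rho ^ j)) in h; [|left; apply pow_lt; lra].
  rewrite <- (tech_pow_Rmult rho j). lra. }
induction N as [|N IH].
- simpl sum_f_R0. unfold rhs_a, inflow. specialize (flux 0%nat).
  rewrite Rpower_pow_base by exact hlam. simpl pow in *.
  assert (h0 := pow2_ge_0 (x 0%nat)). assert (h1 := pow2_ge_0 (y 0%nat)).
  nra.
- rewrite !tech5.
  assert (e : r ^ S N * rhs_a lam theta f x y (S N) =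
    r * (rho ^ N * (x N ^ 2 + y N ^ 2))
    - rho ^ S N * (x (S N) * x (S (S N)) + y (S N) * y (S (S N)))).
  { unfold rhs_a, inflow. rewrite hf by lia.
    rewrite !Rpower_pow_base by exact hlam.
    rewrite erho, !Rpow_mult_distr. simpl pow. ring. }
  rewrite e. specialize (flux (S N)). lra.
Qed.

(** Cauchy-Schwarz for the splitting [r^j x_j = (r k)^j (k^(-j) x_j)]: the first factor has a
    geometric sum of squares bounded uniformly in [N], and [k^(-2j) = rho^j]. *)
Lemma weighted_sum_sqr_le (x y : nat -> R) (r k rho : R) (N : nat) :
  0 < k -> k ^ 2 * rho = 1 -> (r * k) ^ 2 < 1 ->
  (1 - (r * k) ^ 2) * (sum_f_R0 (fun j => r ^ j * x j) N) ^ 2 <=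
  sum_f_R0 (fun j => rho ^ j * (x j ^ 2 + y j ^ 2)) N.
Proof.
intros hk hkr hw.
assert (erho : rho = (/ k) ^ 2).
{ apply (Rmult_eq_reg_l (k ^ 2)); [rewrite hkr; field; lra | nra]. }
assert (h := Cauchy_Schwarz_sum (fun j => (r * k) ^ j)
  (fun j => (/ k) ^ j * x j) N).
rewrite (sum_eq _ (fun j => r ^ j * x j)) in h.
2: { intros j _. rewrite <- Rmult_assoc, <- Rpow_mult_distr. f_equal. f_equal.
     field. lra. }
rewrite (sum_eq (fun j => ((r * k) ^ j) ^ 2) (fun j => ((r * k) ^ 2) ^ j)) in h.
2: { intros j _. rewrite <- !pow_mult. f_equal. lia. }
assert (hg := geometric_sum_le ((r * k) ^ 2) N (conj (pow2_ge_0 _) hw)).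
assert (hS : sum_f_R0 (fun j => ((/ k) ^ j * x j) ^ 2) N <=
             sum_f_R0 (fun j => rho ^ j * (x j ^ 2 + y j ^ 2)) N).
{ apply sum_Rle. intros j _.
  rewrite Rpow_mult_distr, <- pow_mult, Nat.mul_comm, pow_mult, <- erho.
  apply Rmult_le_compat_l.
  - apply pow_le. rewrite erho. apply pow2_ge_0.
  - assert (h1 := pow2_ge_0 (y j)). lra. }
assert (hS0 : 0 <= sum_f_R0 (fun j => ((/ k) ^ j * x j) ^ 2) N)
  by (apply cond_pos_sum; intros; apply pow2_ge_0).
apply Rle_trans with (2 := hS).
apply Rle_trans with ((1 - (r * k) ^ 2) *
  (/ (1 - (r * k) ^ 2) * sum_f_R0 (fun j => ((/ k) ^ j * x j) ^ 2) N)).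
- apply Rmult_le_compat_l; [lra|].
  apply Rle_trans with (1 := h). apply Rmult_le_compat_r; assumption.
- right. field. lra.
Qed.

(** * Termwise control by the [H^s] norm *)

Lemma Hs_norm_sq_ge_term (lam s : R) (u : nat -> R) (j : nat) :
  0 < lam ->
  Rbar_le (Rpower lam (2 * s) ^ j * u j ^ 2) (Hs_norm_sq lam s u).
Proof.
intros hlam.
rewrite <- (Lim_seq_const (Rpower lam (2 * s) ^ j * u j ^ 2)).
apply Lim_seq_le_loc. exists j. intros n hn.
rewrite sum_n_Reals.
assert (hp : forall i, 0 <= Rpower (lam ^ i) (2 * s) * u i ^ 2)
  by (intros i; apply Rmult_le_pos; [left; apply exp_pos | apply pow2_ge_0]).
rewrite <- Rpower_pow_base by exact hlam.
induction hn as [|n hn IH].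
- destruct j as [|j]; [apply Rle_refl | rewrite tech5].
  assert (h := cond_pos_sum _ j hp). lra.
- rewrite tech5. specialize (hp (S n)). lra.
Qed.

Lemma Hs_bound_term (lam s M : R) (u v : nat -> R) (j : nat) :
  0 < lam ->
  Rbar_le (Rbar_plus (Hs_norm_sq lam s u) (Hs_norm_sq lam s v)) M ->
  Rpower lam (2 * s) ^ j * (u j ^ 2 + v j ^ 2) <= M.
Proof.
intros hlam hM.
assert (hu := Hs_norm_sq_ge_term lam s u j hlam).
assert (hv := Hs_norm_sq_ge_term lam s v j hlam).
(* [hu] and [hv] exclude [m_infty], so the default value of [Rbar_plus] on opposite infinities never
   arises; [p_infty] contradicts [hM]. *)
destruct (Hs_norm_sq lam s u), (Hs_norm_sq lam s v); simpl in *; try tauto.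
lra.
Qed.

(** * Blow-up of the truncated functional *)

Lemma is_derive_sum_f_R0 (F : nat -> R -> R) (d : nat -> R) (t : R) (N : nat) :
  (forall j, is_derive (F j) t (d j)) ->
  is_derive (fun u => sum_f_R0 (fun j => F j u) N) t (sum_f_R0 d N).
Proof.
intros h. induction N as [|N IH]; simpl; [apply h|].
apply (is_derive_plus (fun u => sum_f_R0 (fun j => F j u) N) (F (S N)));
  [exact IH | apply h].
Qed.

Lemma continuity_pt_sum_f_R0 (F : nat -> R -> R) (t : R) (N : nat) :
  (forall j, continuity_pt (F j) t) ->
  continuity_pt (fun u => sum_f_R0 (fun j => F j u) N) t.
Proof.
intros h. induction N as [|N IH]; simpl; [apply h|].
apply (continuity_pt_plus (fun u => sum_f_R0 (fun j => F j u) N) (F (S N)));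
  [exact IH | apply h].
Qed.

(** The lower bound on [T] is the Riccati time for [A = a 0 0] and [c = (r - k) (1 - (r k)^2)]. It
    does not involve [M], so one [T] defeats every bound; only the truncation level depends on
    [M]. *)
Lemma Hs_unbounded (lam theta s r k : R) (f : nat -> R) (a b : R -> nat -> R)
    (T M : R) :
  1 < lam -> 0 < r <= 1 -> 0 < k < r ->
  k ^ 2 * (r * Rpower lam theta) = 1 ->
  r * Rpower lam theta < Rpower lam (2 * s) ->
  0 <= f 0%nat -> (forall j : nat, (1 <= j)%nat -> f j = 0) ->
  (forall j t, 0 <= t ->
     D_in (fun u => a u j) (fun u => rhs_a lam theta f (a u) (b u) j)
       half_line t) ->
  (forall j : nat, 0 < a 0 j) ->
  2 / ((r - k) * (1 - (r * k) ^ 2) * a 0 0%nat) <= T ->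
  ~ (forall t, 0 <= t <= T ->
     Rbar_le (Rbar_plus (Hs_norm_sq lam s (a t)) (Hs_norm_sq lam s (b t))) M).
Proof.
intros hlam hr hk hkr hrho hf0 hf hsol hpos hT hM.
assert (hmu : 0 < Rpower lam theta) by apply exp_pos.
set (rho := r * Rpower lam theta) in *.
set (nu := Rpower lam (2 * s)) in *.
assert (rho0 : 0 < rho) by (unfold rho; nra).
set (q := rho / nu).
assert (hq : 0 < q < 1).
{ split; [apply Rdiv_lt_0_compat; lra|].
  apply Rlt_div_l; lra. }
assert (hrk : 0 < r * k < 1) by nra.
assert (hw : (r * k) ^ 2 < 1) by nra.
set (A := a 0 0%nat) in *.
assert (hA : 0 < A) by apply hpos.
set (c := (r - k) * (1 - (r * k) ^ 2)) in *.
assert (hc : 0 < c) by (apply Rmult_lt_0_compat; lra).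
assert (hT0 : 0 < 2 / (c * A)) by (apply Rdiv_lt_0_compat; nra).
assert (hM0 : 0 <= M).
{ assert (h := Hs_bound_term lam s M (a 0) (b 0) 0 ltac:(lra) (hM 0 ltac:(lra))).
  simpl in h. nra. }
assert (hcA : 0 < c * A ^ 2 / 2).
{ assert (0 < A ^ 2) by nra. nra. }
(* Each of the two boundary terms at the cut will be at most [q^N M], so [N] is chosen to put their
   sum below the Riccati loss [c A^2 / 2]. Using [M + 1] keeps the denominator positive when
   [M = 0]. *)
destruct (pow_lt_1_zero q ltac:(rewrite Rabs_pos_eq; lra)
  (c * A ^ 2 / 2 / (2 * (M + 1)))) as [N hN].
{ apply Rdiv_lt_0_compat; lra. }
specialize (hN N (Nat.le_refl N)).
assert (qN0 : 0 < q ^ N) by (apply pow_lt; lra).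
rewrite Rabs_pos_eq in hN by lra.
apply Rlt_div_r in hN; [|lra].
assert (tail : forall j t, 0 <= t <= T ->
  rho ^ j * (a t j ^ 2 + b t j ^ 2) <= q ^ j * M).
{ intros j t ht.
  assert (h := Hs_bound_term lam s M (a t) (b t) j ltac:(lra) (hM t ht)).
  fold nu in h.
  replace (rho ^ j) with (q ^ j * nu ^ j)
    by (rewrite <- Rpow_mult_distr; f_equal; unfold q; field; lra).
  rewrite Rmult_assoc. apply Rmult_le_compat_l; [apply pow_le; lra | exact h]. }
apply (Riccati_blowup
  (fun t => sum_f_R0 (fun j => r ^ j * a (Rmax 0 t) j) N)
  (fun t => sum_f_R0 (fun j => r ^ j * rhs_a lam theta f (a t) (b t) j) N)
  A c T hA hc hT).
- intros t. apply (continuity_pt_sum_f_R0 (fun j t => r ^ j * a (Rmax 0 t) j)).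
  intros j. apply (continuity_pt_scal (fun t => a (Rmax 0 t) j)).
  apply (continuity_of_D_in_half_line (fun t => a t j)) with (1 := hsol j).
- intros t ht. apply (is_derive_sum_f_R0 (fun j t => r ^ j * a (Rmax 0 t) j)).
  intros j. apply (is_derive_scal (fun t => a (Rmax 0 t) j)).
  apply (derive_of_D_in_half_line (fun u => a u j)
    (fun u => rhs_a lam theta f (a u) (b u) j)); [lra | apply hsol; lra].
- intros t ht. rewrite Rmax_right by lra.
  assert (h1 := weighted_sum_rhs_a_ge lam theta f (a t) (b t) r k rho N
    ltac:(lra) ltac:(lra) ltac:(lra) eq_refl hkr hf0 hf).
  assert (h2 := weighted_sum_sqr_le (a t) (b t) r k rho N ltac:(lra) hkr hw).
  apply (Rmult_le_compat_l (r - k)) in h2; [|lra].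
  rewrite <- Rmult_assoc in h2. fold c in h2.
  assert (t1 := tail N t ht). assert (t2 := tail (S N) t ht).
  assert (t2' : q ^ S N * M <= q ^ N * M).
  { assert (h := Rmult_le_pos _ _ (Rlt_le _ _ qN0) hM0). simpl. nra. }
  assert (p1 : 0 <= rho ^ N * (a t N ^ 2 + b t N ^ 2)).
  { apply Rmult_le_pos; [apply pow_le; lra | nra]. }
  assert (p2 : 0 <= rho ^ S N * (a t (S N) ^ 2 + b t (S N) ^ 2)).
  { apply Rmult_le_pos; [apply pow_le; lra | nra]. }
  assert (e1 : r * (rho ^ N * (a t N ^ 2 + b t N ^ 2)) <= q ^ N * M) by nra.
  assert (e2 : k / 2 * (rho ^ S N * (a t (S N) ^ 2 + b t (S N) ^ 2))
               <= q ^ N * M) by nra.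
  lra.
(* The initial value of the sum is at least its term [j = 0], all other terms being positive. *)
- rewrite Rmax_left by lra. clear - hpos hr. unfold A.
  induction N as [|N IH]; [simpl; lra | rewrite tech5].
  assert (h := pow_lt r (S N) (proj1 hr)). assert (h' := hpos (S N)). nra.
Qed.

Theorem theorem5p1 (lam theta : R) (f : nat -> R) (a b : R -> nat -> R)
  (hlam : 1 < lam) (htheta : 0 < theta)
  (hf0 : 0 <= f 0%nat) (hf : forall j : nat, (1 <= j)%nat -> f j = 0)
  (hsol : weak_solution lam theta f a b)
  (hpos : forall j : nat, 0 < a 0 j /\ 0 < b 0 j) :
  forall s : R, / 3 * theta < s ->
  exists T : R, 0 < T /\
    Rbar_is_lub
      (fun y : Rbar => exists t : R, 0 <= t <= T /\
         y = Rbar_plus (Hs_norm_sq lam s (a t)) (Hs_norm_sq lam s (b t)))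
      p_infty.
Proof.
intros s hs.
(* [rho = mu r = lam^tau] and [k = rho^(-1/2)]; [tau > 2 theta / 3] gives
   [k < r], and [tau < 2 s] leaves room for the tail estimate. *)
set (tau := Rmin theta (/ 3 * theta + s)).
(* [/ 3 * theta + s] is the midpoint of [2 / 3 * theta] and [2 * s]; the cap at [theta] ensures
   [r <= 1]. *)
assert (htau : 2 / 3 * theta < tau /\ tau <= theta /\ tau < 2 * s).
{ unfold tau, Rmin. destruct Rle_dec; lra. }
set (r := Rpower lam (tau - theta)).
set (k := Rpower lam (- tau / 2)).
assert (r0 : 0 < r) by apply exp_pos.
assert (r1 : r <= 1).
{ rewrite <- (Rpower_O lam) by lra. apply Rle_Rpower; lra. }
assert (k0 : 0 < k) by apply exp_pos.
assert (kr : k < r) by (apply Rpower_lt; lra).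
assert (erho : r * Rpower lam theta = Rpower lam tau).
{ unfold r. rewrite <- Rpower_plus. f_equal. ring. }
assert (hkr : k ^ 2 * (r * Rpower lam theta) = 1).
{ rewrite erho. unfold k. rewrite <- Rpower_pow, Rpower_mult, <- Rpower_plus
    by apply exp_pos.
  replace (- tau / 2 * INR 2 + tau) with 0 by (simpl; field).
  apply Rpower_O; lra. }
assert (hrho : r * Rpower lam theta < Rpower lam (2 * s)).
{ rewrite erho. apply Rpower_lt; lra. }
assert (hT : 0 < 2 / ((r - k) * (1 - (r * k) ^ 2) * a 0 0%nat)).
{ assert (hrk : 0 < r * k < 1) by nra.
  assert (hw : (r * k) ^ 2 < 1) by nra.
  apply Rdiv_lt_0_compat; [lra|].
  repeat apply Rmult_lt_0_compat; try lra. apply hpos. }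
eexists; split; [exact hT|].
assert (key := fun M => Hs_unbounded lam theta s r k f a b _ M hlam (conj r0 r1)
  (conj k0 kr) hkr hrho hf0 hf (fun j t ht => proj1 (proj2 (proj2 hsol) j t ht))
  (fun j => proj1 (hpos j)) (Rle_refl _)).
split; [intros y _; destruct y; exact I|].
(* A real upper bound contradicts [key], and [m_infty] as an upper bound would make 0 one too. *)
intros [M| |] hub; [| exact I |]; exfalso.
- apply (key M). intros t ht. apply hub. exists t. auto.
- apply (key 0). intros t ht. apply Rbar_le_trans with m_infty; [|exact I].
  apply hub. exists t. auto.
Qed.
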